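(* Let $Q$ be a finite acyclic quiver, $W$ a finite-dimensional representation of $Q$ over a field $\mathbb{F}$, and $\sigma\in\mathbb{Z}^{Q_0}$ a weight. Let $n=\min\{\sum_x\sigma_+(x)\dim W(x),\sum_x\sigma_-(x)\dim W(x)\}$, assume $|\mathbb{F}|>n$, and let $d\ge n-1$ be a positive integer. Let $\mathcal{A}$ be the matrix space, $c$ its maximal shrinking number, and $\mathcal{A}^{\{d\}}$ its $d$-th tensor blow-up, as defined in the context. Let $A\in\mathcal{A}^{\{d\}}$ satisfy $\operatorname{rk}A=\operatorname{ncrk}\mathcal{A}^{\{d\}}$, let $B$ be a pseudo-inverse of $A$, and let the quiver $Q^+$, the representation $W^+$ of $Q^+$ and the subspaces $K(x)\subseteq W(x)$ be constructed from $A$ and $B$ as in the context. Let $W'$ be the smallest subrepresentation of $W^+$ with $K(x)\subseteq W'(x)$ for all $x\in Q_0$. Then $\bigoplus_{x\in Q_0}W'(x)^{d\sigma_+(x)}$ is a $cd$-shrunk subspace of $\mathcal{A}^{\{d\}}$, with image under $\mathcal{A}^{\{d\}}$ equal to $\bigoplus_{x\in Q_0}W'(x)^{d\sigma_-(x)}$. Thus $W'$ (regarded as a subrepresentation of $W$) is an optimal $\sigma$-witness of $W$.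
   Context: $\sigma_+(x)=\max\{0,\sigma(x)\}$, $\sigma_-(x)=-\min\{0,\sigma(x)\}$, $\sigma(\underline{\dim}\,W')=\sum_{x\in Q_0}\sigma(x)\dim W'(x)$. An optimal $\sigma$-witness of $W$ is a subrepresentation $W'$ of $W$ for which $\sigma(\underline{\dim}\,W')$ is maximal among all subrepresentations of $W$. Matrix space: $\mathcal{A}$ is the space of all linear maps $\bigoplus_xW(x)^{\sigma_+(x)}\to\bigoplus_xW(x)^{\sigma_-(x)}$ in which each block from a copy of $W(x)$ (with $\sigma(x)>0$) to a copy of $W(y)$ (with $\sigma(y)<0$) is an arbitrary linear combination of the maps $W(p)$, $p$ a path from $x$ to $y$ in $Q$. Its blow-up $\mathcal{A}^{\{d\}}=M(d,\mathbb{F})\otimes\mathcal{A}$ is a space of linear maps $\bigoplus_xW(x)^{d\sigma_+(x)}\to\bigoplus_xW(x)^{d\sigma_-(x)}$. Shrunk subspaces: for a space $\mathcal{B}$ of linear maps and a subspace $U$ of the domain, the image $\mathcal{B}(U)$ is the span of all $Mu$, $M\in\mathcal{B}$, $u\in U$. A subspace $U$ is $k$-shrunk for $\mathcal{B}$ if $\dim\mathcal{B}(U)\le\dim U-k$. Here $c=\max_U(\dim U-\dim\mathcal{A}(U))$ over subspaces $U$ of $\bigoplus_xW(x)^{\sigma_+(x)}$. Non-commutative rank: $\operatorname{ncrk}\mathcal{B}$ is the rank over the free skew field of $\sum_i x_iB_i$, where $B_1,B_2,\dots$ spans $\mathcal{B}$ and the $x_i$ are non-commuting variables. Known facts: $\operatorname{ncrk}\mathcal{B}=\dim(\text{domain})-\max_U(\dim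 U-\dim\mathcal{B}(U))$ and $\operatorname{ncrk}\mathcal{A}^{\{d\}}=d\operatorname{ncrk}\mathcal{A}$; hence the condition on $A$ says $\dim\ker A=cd$. Pseudo-inverse: $B:\bigoplus_xW(x)^{d\sigma_-(x)}\to\bigoplus_xW(x)^{d\sigma_+(x)}$ is a linear map whose restriction to $\operatorname{im}(A)$ is the inverse of the restriction of $A$ to some direct complement of $\ker A$. Construction of $Q^+,W^+$: for $x$ with $\sigma(x)>0$ and $1\le j\le d\sigma(x)$ let $\pi_{x,j}:\bigoplus_{x'}W(x')^{d\sigma_+(x')}\to W(x)$ be the projection to the $j$-th copy of $W(x)$; for $y$ with $\sigma(y)<0$ and $1\le i\le d|\sigma(y)|$ let $\iota_{y,i}:W(y)\to\bigoplus_{y'}W(y')^{d\sigma_-(y')}$ be the inclusion of the $i$-th copy of $W(y)$. $Q^+$ is obtained from $Q$ by adding, for all such $x,j,y,i$, a new arrow $p:y\to x$; $W^+$ agrees with $W$ on $Q$, and $W^+(p)=\pi_{x,j}\circ B\circ\iota_{y,i}:W(y)\to W(x)$ (the corresponding block of $B$). Subspaces: $K(x)=\sum_{j=1}^{d\sigma(x)}\pi_{x,j}(\ker A)$ if $\sigma(x)>0$, and $K(x)=0$ for all other vertices. *)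

(* Defs.v *)
From HB Require Import structures.
From mathcomp Require Import all_boot all_order all_algebra.
From mathcomp Require Import boolp.
From mathcomp.multinomials Require Import monalg.
From mathcomp Require Import zify.

Set Implicit Arguments.
Unset Strict Implicit.
Unset Printing Implicit Defensive.

Import Order.TTheory GRing.Theory Num.Theory VectorInternalTheory.
Local Open Scope ring_scope.

Definition lin_comb (F : fieldType) (V : vectType F) (S : V -> Prop) (v : V)
    : Prop :=
  exists (n : nat) (a : 'I_n -> F) (u : 'I_n -> V),
    (forall i, S (u i)) /\ v = \sum_(i < n) a i *: u i.

Lemma lin_span_subproof (F : fieldType) (V : vectType F) (S : V -> Prop) :
  exists U : {vspace V}, forall v, v \in U <-> lin_comb S v.
Proof.
suff [s sS spanS] : exists2 s : seq V,
    forall v, v \in s -> S v & forall v, S v -> v \in <<s>>%VS.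
  exists <<s>>%VS => v; split; last first.
    move=> [n [a [u [uS ->]]]]; apply: memv_suml => i _.
    by apply/memvZ/spanS.
  move=> vs; exists (size s), (fun i => coord (in_tuple s) i v), (fun i => s`_i).
  split=> [i|]; first exact/sS/mem_nth.
  by rewrite {1}(@coord_span _ _ _ (in_tuple s) v vs).
suff H k (s : seq V) : (forall v, v \in s -> S v) ->
    (\dim {:V} - \dim <<s>> <= k)%N ->
    exists2 s : seq V, forall v, v \in s -> S v & forall v, S v -> v \in <<s>>%VS.
  by apply: (H _ [::] _ (leqnn _)).
elim: k s => [|k IH] s sS sk.
  exists s => // v _.
  have /eqP -> : (<<s>> == fullv)%VS; last exact: memvf.
  by rewrite eqEdim subvf /= -subn_eq0 -leqn0.
have [all_s|/existsNP [v /not_implyP [Sv /negP vs]]] :=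
  pselect (forall v, S v -> v \in <<s>>%VS); first by exists s.
apply: (IH (v :: s)).
  by move=> w; rewrite inE => /orP [/eqP ->|/sS].
rewrite span_cons.
have lt : (\dim <<s>> < \dim (<[v]> + <<s>>))%N.
  rewrite ltn_neqAle dimvS ?addvSr // andbT.
  apply/negP => /eqP e; move/negP: vs; apply.
  have /eqP -> : (<<s>> == <[v]> + <<s>>)%VS by rewrite eqEdim addvSr e /=.
  by rewrite (subvP (addvSl _ _)) // memv_line.
have : (\dim (<[v]> + <<s>>) <= \dim {:V})%N by exact: dimvS (subvf _).
by move: lt sk; lia.
Qed.

Definition lin_span (F : fieldType) (V : vectType F) (S : V -> Prop)
    : {vspace V} :=
  sval (cid (lin_span_subproof S)).

Lemma lin_spanP (F : fieldType) (V : vectType F) (S : V -> Prop) (v : V) :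
  v \in lin_span S <-> lin_comb S v.
Proof. exact: (svalP (cid (lin_span_subproof S)) v). Qed.

(* The library's {ffun I -> V} has a vector space structure only for a        *)
(* constant family V.                                                         *)

Definition dsum (F : fieldType) (I : finType) (V : I -> vectType F) : Type :=
  {dffun forall i : I, V i}.

HB.instance Definition _ (F : fieldType) (I : finType) (V : I -> vectType F) :=
  Choice.on (dsum V).

Definition dsum_mk (F : fieldType) (I : finType) (V : I -> vectType F)
    (f : forall i, V i) : dsum V := finfun f.

Lemma dsum_mkE (F : fieldType) (I : finType) (V : I -> vectType F)
  (f : forall i, V i) (i : I) : dsum_mk f i = f i.
Proof. exact: ffunE. Qed.

Lemma dsumP (F : fieldType) (I : finType) (V : I -> vectType F)
  (u v : dsum V) : (forall i, u i = v i) <-> u = v.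
Proof. by split=> [uv|-> //]; apply/ffunP. Qed.

Definition dsum_add (F : fieldType) (I : finType) (V : I -> vectType F)
  (u v : dsum V) : dsum V := dsum_mk (fun i => u i + v i).
Definition dsum_opp (F : fieldType) (I : finType) (V : I -> vectType F)
  (u : dsum V) : dsum V := dsum_mk (fun i => - u i).
Definition dsum_zero (F : fieldType) (I : finType) (V : I -> vectType F)
  : dsum V := dsum_mk (fun i => 0).
Definition dsum_scale (F : fieldType) (I : finType) (V : I -> vectType F)
  (a : F) (u : dsum V) : dsum V := dsum_mk (fun i => a *: u i).

Fact dsum_addA (F : fieldType) (I : finType) (V : I -> vectType F) :
  associative (@dsum_add F I V).
Proof. by move=> u v w; apply/dsumP => i; rewrite !dsum_mkE addrA. Qed.
Fact dsum_addC (F : fieldType) (I : finType) (V : I -> vectType F) :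
  commutative (@dsum_add F I V).
Proof. by move=> u v; apply/dsumP => i; rewrite !dsum_mkE addrC. Qed.
Fact dsum_add0 (F : fieldType) (I : finType) (V : I -> vectType F) :
  left_id (@dsum_zero F I V) (@dsum_add F I V).
Proof. by move=> u; apply/dsumP => i; rewrite !dsum_mkE add0r. Qed.
Fact dsum_addN (F : fieldType) (I : finType) (V : I -> vectType F) :
  left_inverse (@dsum_zero F I V) (@dsum_opp F I V) (@dsum_add F I V).
Proof. by move=> u; apply/dsumP => i; rewrite !dsum_mkE addNr. Qed.

HB.instance Definition _ (F : fieldType) (I : finType) (V : I -> vectType F) :=
  GRing.isZmodule.Build (dsum V)
    (@dsum_addA F I V) (@dsum_addC F I V) (@dsum_add0 F I V) (@dsum_addN F I V).

Fact dsum_scaleA (F : fieldType) (I : finType) (V : I -> vectType F)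
  (a b : F) (u : dsum V) : dsum_scale a (dsum_scale b u) = dsum_scale (a * b) u.
Proof. by apply/dsumP => i; rewrite !dsum_mkE scalerA. Qed.
Fact dsum_scale1 (F : fieldType) (I : finType) (V : I -> vectType F) :
  left_id 1 (@dsum_scale F I V).
Proof. by move=> u; apply/dsumP => i; rewrite !dsum_mkE scale1r. Qed.
Fact dsum_scaleDr (F : fieldType) (I : finType) (V : I -> vectType F) :
  right_distributive (@dsum_scale F I V) +%R.
Proof. by move=> a u v; apply/dsumP => i; rewrite !dsum_mkE scalerDr. Qed.
Fact dsum_scaleDl (F : fieldType) (I : finType) (V : I -> vectType F)
  (u : dsum V) : {morph (@dsum_scale F I V)^~ u : a b / a + b}.
Proof. by move=> a b; apply/dsumP => i; rewrite !dsum_mkE scalerDl. Qed.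

HB.instance Definition _ (F : fieldType) (I : finType) (V : I -> vectType F) :=
  GRing.Zmodule_isLmodule.Build F (dsum V)
    (@dsum_scaleA F I V) (@dsum_scale1 F I V)
    (@dsum_scaleDr F I V) (@dsum_scaleDl F I V).

Lemma dsumDE (F : fieldType) (I : finType) (V : I -> vectType F)
  (u v : dsum V) (i : I) : (u + v) i = u i + v i.
Proof. exact: dsum_mkE. Qed.

Lemma dsumZE (F : fieldType) (I : finType) (V : I -> vectType F)
  (a : F) (u : dsum V) (i : I) : (a *: u) i = a *: u i.
Proof. exact: dsum_mkE. Qed.

Fact dsum_vect_iso (F : fieldType) (I : finType) (V : I -> vectType F) :
  Vector.axiom #|{: {i : I & 'I_(dim (V i))}}| (dsum V).
Proof.
pose K : finType := {i : I & 'I_(dim (V i))}.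
pose f (u : dsum V) : 'rV[F]_#|K| :=
  \row_k v2r (u (tag (enum_val k))) 0 (tagged (enum_val k)).
pose g (r : 'rV[F]_#|K|) : dsum V := dsum_mk
  (fun i => r2v (\row_j r 0 (enum_rank (Tagged (fun i => 'I_(dim (V i))) j)))).
exists f.
  by move=> a u v; apply/rowP => k; rewrite !mxE dsumDE dsumZE linearP !mxE.
exists g => [u|r].
  apply/dsumP => i; rewrite dsum_mkE; apply: (canLR v2rK).
  by apply/rowP => j; rewrite !mxE enum_rankK.
apply/rowP => k; rewrite -[k]enum_valK; case: (enum_val k) => i j.
by rewrite !mxE enum_rankK /= dsum_mkE r2vK mxE.
Qed.

HB.instance Definition _ (F : fieldType) (I : finType) (V : I -> vectType F) :=
  Lmodule_hasFinDim.Build F (dsum V) (@dsum_vect_iso F I V).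

Definition dsum_proj (F : fieldType) (I : finType) (V : I -> vectType F)
  (i : I) : 'Hom(dsum V, V i) := linfun (fun u : dsum V => u i).

Fact dsum_proj_linear (F : fieldType) (I : finType) (V : I -> vectType F)
  (i : I) : linear (fun u : dsum V => u i).
Proof. by move=> a u v; rewrite dsumDE dsumZE. Qed.

Lemma dsum_projE (F : fieldType) (I : finType) (V : I -> vectType F)
  (i : I) (u : dsum V) : dsum_proj V i u = u i.
Proof.
pose L := GRing.isLinear.Build F (dsum V) (V i) *:%R _ (@dsum_proj_linear F I V i).
pose f : {linear dsum V -> V i} := HB.pack (fun u : dsum V => u i) L.
exact: (lfunE f).
Qed.

Definition dsum_in (F : fieldType) (I : finType) (V : I -> vectType F)
    (i : I) (w : V i) : dsum V :=
  dsum_mk (fun k => if i =P k is ReflectT e then ecast k (V k) e w else 0).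

Definition dsum_inj (F : fieldType) (I : finType) (V : I -> vectType F)
  (i : I) : 'Hom(V i, dsum V) := linfun (@dsum_in F I V i).

Fact dsum_in_linear (F : fieldType) (I : finType) (V : I -> vectType F)
  (i : I) : linear (@dsum_in F I V i).
Proof.
move=> a u v; apply/dsumP => k; rewrite dsumDE dsumZE !dsum_mkE.
by case: eqP => [e|_]; [case: k / e | rewrite scaler0 addr0].
Qed.

Lemma dsum_injE (F : fieldType) (I : finType) (V : I -> vectType F)
  (i : I) (w : V i) : dsum_inj V i w = dsum_in w.
Proof.
pose L := GRing.isLinear.Build F (V i) (dsum V) *:%R _ (@dsum_in_linear F I V i).
pose f : {linear V i -> dsum V} := HB.pack (@dsum_in F I V i) L.
exact: (lfunE f).
Qed.

Lemma dsum_in_same (F : fieldType) (I : finType) (V : I -> vectType F)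
  (i : I) (w : V i) : dsum_in w i = w.
Proof. by rewrite dsum_mkE; case: eqP => // e; rewrite eq_axiomK. Qed.

Lemma dsum_in_diff (F : fieldType) (I : finType) (V : I -> vectType F)
  (i k : I) (w : V i) : i != k -> dsum_in w k = 0.
Proof. by rewrite dsum_mkE; case: eqP. Qed.

Definition pow_proj (F : fieldType) (d : nat) (V : vectType F) (k : 'I_d)
  : 'Hom({ffun 'I_d -> V}, V) := linfun (fun u : {ffun 'I_d -> V} => u k).

Lemma pow_projE (F : fieldType) (d : nat) (V : vectType F) (k : 'I_d)
  (u : {ffun 'I_d -> V}) : pow_proj V k u = u k.
Proof.
have lin : linear (fun u : {ffun 'I_d -> V} => u k).
  by move=> a v w; rewrite !ffunE.
pose L := GRing.isLinear.Build F {ffun 'I_d -> V} V *:%R _ lin.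
pose f : {linear {ffun 'I_d -> V} -> V} :=
  HB.pack (fun u : {ffun 'I_d -> V} => u k) L.
exact: (lfunE f).
Qed.

Definition pow_inj (F : fieldType) (d : nat) (V : vectType F) (k : 'I_d)
  : 'Hom(V, {ffun 'I_d -> V}) :=
  linfun (fun w : V => [ffun l => if l == k then w else 0]).

Lemma pow_injE (F : fieldType) (d : nat) (V : vectType F) (k : 'I_d) (w : V) :
  pow_inj V k w = [ffun l => if l == k then w else 0].
Proof.
have lin : linear (fun w : V => [ffun l : 'I_d => if l == k then w else 0]).
  move=> a v x; apply/ffunP => l; rewrite !ffunE.
  by case: ifP; rewrite // scaler0 addr0.
pose L := GRing.isLinear.Build F V {ffun 'I_d -> V} *:%R _ lin.
pose f : {linear V -> {ffun 'I_d -> V}} :=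
  HB.pack (fun w : V => [ffun l : 'I_d => if l == k then w else 0]) L.
exact: (lfunE f).
Qed.

Definition space_image (F : fieldType) (V V' : vectType F)
    (B : {vspace 'Hom(V, V')}) (U : {vspace V}) : {vspace V'} :=
  lin_span (fun w => exists M u, [/\ M \in B, u \in U & w = M u]).

Definition shrunk (F : fieldType) (V V' : vectType F)
    (B : {vspace 'Hom(V, V')}) (k : nat) (U : {vspace V}) : Prop :=
  (\dim (space_image B U) + k <= \dim U)%N.

(* c is the maximum of dim U - dim B(U); it is nonnegative because of U = 0.  *)
Definition max_shrinking (F : fieldType) (V V' : vectType F)
    (B : {vspace 'Hom(V, V')}) (c : nat) : Prop :=
  (exists U, \dim U = (\dim (space_image B U) + c)%N) /\
  (forall U, (\dim U <= \dim (space_image B U) + c)%N).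

(* The map E (x) M from F^d (x) V = V^d to F^d (x) V' = V'^d.                 *)
Definition kron (F : fieldType) (d : nat) (V V' : vectType F)
    (E : 'M[F]_d) (M : 'Hom(V, V')) : 'Hom({ffun 'I_d -> V}, {ffun 'I_d -> V'}) :=
  linfun (fun u : {ffun 'I_d -> V} => [ffun k => \sum_l E k l *: M (u l)]).

Lemma kronE (F : fieldType) (d : nat) (V V' : vectType F)
  (E : 'M[F]_d) (M : 'Hom(V, V')) (u : {ffun 'I_d -> V}) :
  kron E M u = [ffun k => \sum_l E k l *: M (u l)].
Proof.
pose g (u : {ffun 'I_d -> V}) := [ffun k => \sum_l E k l *: M (u l)].
have lin : linear g.
  move=> a v w; apply/ffunP => k; rewrite !ffunE scaler_sumr -big_split /=.
  apply: eq_bigr => l _.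
  by rewrite !ffunE linearP scalerDr !scalerA [E k l * a]mulrC.
pose L := GRing.isLinear.Build F {ffun 'I_d -> V} {ffun 'I_d -> V'} *:%R _ lin.
pose f : {linear {ffun 'I_d -> V} -> {ffun 'I_d -> V'}} := HB.pack g L.
exact: (lfunE f).
Qed.

Definition blowup (F : fieldType) (d : nat) (V V' : vectType F)
    (B : {vspace 'Hom(V, V')})
    : {vspace 'Hom({ffun 'I_d -> V}, {ffun 'I_d -> V'})} :=
  lin_span (fun N => exists E M, M \in B /\ N = kron E M).

Definition pseudo_inverse (F : fieldType) (V V' : vectType F)
    (A : 'Hom(V, V')) (B : 'Hom(V', V)) : Prop :=
  exists C : {vspace V},
    [/\ (lker A + C)%VS = fullv, (lker A :&: C)%VS = 0%VS
      & forall v, v \in C -> B (A v) = v].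

(* The free algebra F<x_i : i in I> is the monoid algebra of the free monoid. *)

Definition free_alg (F : fieldType) (I : choiceType) : nzRingType :=
  {malg F[{fmonom I}]}.

Definition free_var (F : fieldType) (I : choiceType) (i : I)
    : {malg F[{fmonom I}]} :=
  << fmu i >>.

Definition full_mx (R : nzRingType) (n : nat) (M : 'M[R]_n) : Prop :=
  forall (k : nat) (P : 'M[R]_(n, k)) (Q : 'M[R]_(k, n)),
    M = P *m Q -> (n <= k)%N.

(* unitmx requires a commutative ring.                                        *)
Definition inv_mx (R : nzRingType) (n : nat) (M : 'M[R]_n) : Prop :=
  exists N : 'M[R]_n, M *m N = 1%:M /\ N *m M = 1%:M.

Definition inverts_full (R S : nzRingType) (f : {rmorphism R -> S}) : Prop :=
  forall (n : nat) (M : 'M[R]_n), full_mx M -> inv_mx (map_mx f M).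

(* The free skew field is the universal field of fractions of the free        *)
(* algebra: a division ring that is the universal localization of the free    *)
(* algebra at its full matrices (P. M. Cohn).  This determines it up to a     *)
(* unique isomorphism over the free algebra.                                  *)
Record is_free_skew_field (F : fieldType) (I : choiceType) (D : unitRingType)
    (iota : {rmorphism free_alg F I -> D}) : Prop := IsFreeSkewField {
  fsf_division : forall x : D, x != 0 -> x \is a GRing.unit;
  fsf_inverts : inverts_full iota;
  fsf_universal : forall (S : nzRingType) (f : {rmorphism free_alg F I -> S}),
    inverts_full f ->
    exists g : {rmorphism D -> S}, (forall a, g (iota a) = f a) /\
      (forall g' : {rmorphism D -> S}, (forall a, g' (iota a) = f a) -> g' =1 g)
}.

(* Rank over a division ring: the maximal number of right linearly            *)
(* independent columns.                                                       *)
Definition skew_rank (D : nzRingType) (m n : nat) (M : 'M[D]_(m, n)) : nat :=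
  \max_(J : {set 'I_n} | `[< forall v : 'cV[D]_n,
      (forall j, j \notin J -> v j 0 = 0) -> M *m v = 0 -> v = 0 >]) #|J|.

(* Matrix of a linear map, acting on column vectors of coordinates.           *)
Definition mx_of_hom (F : fieldType) (V V' : vectType F) (M : 'Hom(V, V'))
    : 'M[F]_(\dim {:V'}, \dim {:V}) :=
  \matrix_(i, j) coord (vbasis {:V'}) i (M (vbasis {:V})`_j).

Definition generic_mx (F : fieldType) (V V' : vectType F) (m : nat)
    (Bs : m.-tuple 'Hom(V, V'))
    : 'M[free_alg F 'I_m]_(\dim {:V'}, \dim {:V}) :=
  \matrix_(i, j) \sum_(k < m) mx_of_hom (tnth Bs k) i j *: free_var F k.

Definition is_ncrk (F : fieldType) (V V' : vectType F)
    (B : {vspace 'Hom(V, V')}) (r : nat) : Prop :=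
  exists (m : nat) (Bs : m.-tuple 'Hom(V, V')) (D : unitRingType)
      (iota : {rmorphism free_alg F 'I_m -> D}),
    [/\ <<Bs>>%VS = B, is_free_skew_field iota
      & r = skew_rank (map_mx iota (generic_mx Bs))].

Record quiver := Quiver {
  vertex : finType;
  arrow : finType;
  qsrc : arrow -> vertex;
  qtgt : arrow -> vertex
}.

Inductive qpath (Q : quiver) (x : vertex Q) : vertex Q -> Type :=
| qnil : qpath x x
| qsnoc (a : arrow Q) : qpath x (qsrc a) -> qpath x (qtgt a).

Fixpoint qlength (Q : quiver) (x y : vertex Q) (p : qpath x y) : nat :=
  if p is qsnoc a p' then (qlength p').+1 else 0%N.

Definition acyclic (Q : quiver) : Prop :=
  forall (x : vertex Q) (p : qpath x x), qlength p = 0%N.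

Record rep (F : fieldType) (Q : quiver) := Rep {
  rspace :> vertex Q -> vectType F;
  rmap : forall a : arrow Q, 'Hom(rspace (qsrc a), rspace (qtgt a))
}.

Fixpoint path_map (F : fieldType) (Q : quiver) (W : rep F Q) (x y : vertex Q)
    (p : qpath x y) : 'Hom(W x, W y) :=
  match p in qpath _ z return 'Hom(W x, W z) with
  | qnil => \1%VF
  | qsnoc a p' => (rmap W a \o path_map W p')%VF
  end.

Definition subrep (F : fieldType) (Q : quiver) (W : rep F Q)
    (W' : forall x, {vspace W x}) : Prop :=
  forall a : arrow Q, (rmap W a @: W' (qsrc a) <= W' (qtgt a))%VS.

Definition wpos (Q : quiver) (sigma : vertex Q -> int) (x : vertex Q) : nat :=
  absz (Num.max 0 (sigma x)).

Definition wneg (Q : quiver) (sigma : vertex Q -> int) (x : vertex Q) : nat :=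
  absz (- Num.min 0 (sigma x)).

Definition weight_dim (F : fieldType) (Q : quiver) (W : rep F Q)
    (sigma : vertex Q -> int) (W' : forall x, {vspace W x}) : int :=
  \sum_x sigma x * (\dim (W' x))%:Z.

Definition optimal_witness (F : fieldType) (Q : quiver) (W : rep F Q)
    (sigma : vertex Q -> int) (W' : forall x, {vspace W x}) : Prop :=
  subrep W' /\
  forall U : forall x, {vspace W x}, subrep U ->
    weight_dim sigma U <= weight_dim sigma W'.

Definition copies (Q : quiver) (m : vertex Q -> nat) : finType :=
  {x : vertex Q & 'I_(m x)}.

Definition mult_sum (F : fieldType) (Q : quiver) (W : rep F Q)
    (m : vertex Q -> nat) : vectType F :=
  dsum (fun i : copies m => W (tag i)).

Definition path_blocks (F : fieldType) (Q : quiver) (W : rep F Q)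
    (sigma : vertex Q -> int)
    (M : 'Hom(mult_sum W (wpos sigma), mult_sum W (wneg sigma))) : Prop :=
  forall (i : copies (wpos sigma)) (j : copies (wneg sigma)),
    lin_comb (fun f => exists p : qpath (tag i) (tag j), f = path_map W p)
      (dsum_proj (fun j : copies (wneg sigma) => W (tag j)) j \o M
        \o dsum_inj (fun i : copies (wpos sigma) => W (tag i)) i)%VF.

(* By matrix_spaceP below, the span adds nothing here: it only turns a        *)
(* linearly closed predicate into a {vspace _}.                               *)
Definition matrix_space (F : fieldType) (Q : quiver) (W : rep F Q)
    (sigma : vertex Q -> int)
    : {vspace 'Hom(mult_sum W (wpos sigma), mult_sum W (wneg sigma))} :=
  lin_span (@path_blocks F Q W sigma).

Lemma matrix_spaceP (F : fieldType) (Q : quiver) (W : rep F Q)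
  (sigma : vertex Q -> int)
  (M : 'Hom(mult_sum W (wpos sigma), mult_sum W (wneg sigma))) :
  M \in matrix_space W sigma <-> path_blocks M.
Proof.
rewrite lin_spanP; split=> [[n [a [u [uS ->]]]] i j|MS]; last first.
  by exists 1%N, (fun=> 1), (fun=> M); rewrite big_ord1 scale1r.
have -> : (dsum_proj (fun j : copies (wneg sigma) => W (tag j)) j
    \o (\sum_(k < n) a k *: u k)
    \o dsum_inj (fun i : copies (wpos sigma) => W (tag i)) i)%VF
  = \sum_(k < n) a k *: (dsum_proj (fun j : copies (wneg sigma) => W (tag j)) j
    \o u k \o dsum_inj (fun i : copies (wpos sigma) => W (tag i)) i)%VF.
  apply/lfunP => w; rewrite !comp_lfunE !sum_lfunE linear_sum /=.
  by apply: eq_bigr => k _; rewrite !lfunE /= linearZ /= !lfunE /= !lfunE.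
apply/lin_spanP/memv_suml => k _; apply: memvZ.
by apply/lin_spanP; apply: uS.
Qed.

(* The d m(x) copies of W(x) are numbered by pairs of a number below d and a  *)
(* number below m(x), matching F^d (x) mult_sum W m, the space on which       *)
(* M(d, F) (x) matrix_space acts.                                             *)
Definition blowup_sum (F : fieldType) (Q : quiver) (W : rep F Q)
    (m : vertex Q -> nat) (d : nat) : vectType F :=
  {ffun 'I_d -> mult_sum W m}.

Definition copy_proj (F : fieldType) (Q : quiver) (W : rep F Q)
    (m : vertex Q -> nat) (d : nat) (i : 'I_d * copies m)
    : 'Hom(blowup_sum W m d, W (tag i.2)) :=
  (dsum_proj (fun i : copies m => W (tag i)) i.2
    \o pow_proj (mult_sum W m) i.1)%VF.

Definition copy_inj (F : fieldType) (Q : quiver) (W : rep F Q)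
    (m : vertex Q -> nat) (d : nat) (i : 'I_d * copies m)
    : 'Hom(W (tag i.2), blowup_sum W m d) :=
  (pow_inj (mult_sum W m) i.1
    \o dsum_inj (fun i : copies m => W (tag i)) i.2)%VF.

Definition blowup_sub (F : fieldType) (Q : quiver) (W : rep F Q)
    (m : vertex Q -> nat) (d : nat) (W' : forall x, {vspace W x})
    : {vspace blowup_sum W m d} :=
  (\bigcap_(i : 'I_d * copies m) (copy_proj W i @^-1: W' (tag i.2)))%VS.

(* One new arrow for each pair of a copy of some W(y) in the codomain and a   *)
(* copy of some W(x) in the domain.                                           *)
Definition quiver_plus (Q : quiver) (sigma : vertex Q -> int) (d : nat)
    : quiver :=
  @Quiver (vertex Q)
    (arrow Q + ('I_d * copies (wneg sigma)) * ('I_d * copies (wpos sigma)))%type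
    (fun a => match a with inl b => qsrc b | inr p => tag p.1.2 end)
    (fun a => match a with inl b => qtgt b | inr p => tag p.2.2 end).

Definition rep_plus (F : fieldType) (Q : quiver) (W : rep F Q)
    (sigma : vertex Q -> int) (d : nat)
    (B : 'Hom(blowup_sum W (wneg sigma) d, blowup_sum W (wpos sigma) d))
    : rep F (quiver_plus sigma d) :=
  @Rep F (quiver_plus sigma d) (rspace W)
    (fun a => match a with
      | inl b => rmap W b
      | inr p => (copy_proj W p.2 \o B \o copy_inj W p.1)%VF
      end).

Definition kernel_part (F : fieldType) (Q : quiver) (W : rep F Q)
    (sigma : vertex Q -> int) (d : nat)
    (A : 'Hom(blowup_sum W (wpos sigma) d, blowup_sum W (wneg sigma) d))
    (x : vertex Q) : {vspace W x} :=
  (\sum_(p : 'I_d * 'I_(wpos sigma x))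
    (copy_proj W (p.1, Tagged (fun x => 'I_(wpos sigma x)) p.2) @: lker A
     : {vspace W x}))%VS.

Definition smallest_subrep_above (F : fieldType) (Q : quiver) (W : rep F Q)
    (K W' : forall x, {vspace W x}) : Prop :=
  [/\ subrep W', forall x, (K x <= W' x)%VS
    & forall U : forall x, {vspace W x}, subrep U ->
        (forall x, (K x <= U x)%VS) -> forall x, (W' x <= U x)%VS].

Definition min_dim (F : fieldType) (Q : quiver) (W : rep F Q)
    (sigma : vertex Q -> int) : nat :=
  minn (\sum_x wpos sigma x * \dim {:W x})%N
       (\sum_x wneg sigma x * \dim {:W x})%N.

(* |F| > n, for a field that may be infinite.                                 *)
Definition card_gt (F : fieldType) (n : nat) : Prop :=
  exists s : seq F, uniq s /\ (n < size s)%N.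

(* Main.v *)
(* Let Bl be the blow-up of the matrix space and K the kernel of A.           *)
(* - Since Bl(X) = F^d (x) A(X_1), with X_1 the sum of the components of X,   *)
(*   Bl shrinks by at most cd, and F^d (x) U attains cd if U attains c.       *)
(* - dim K <= cd.  If an n x n linear matrix over the free algebra factors as *)
(*   M = P Q through k < n, then P_0 Q_0 = 0 in degree 0 and                  *)
(*   M = P_0 Q_1 + P_1 Q_0 in degree 1, so M maps ker Q_0 into im P_0, which  *)
(*   is smaller.  Hence a linear matrix that shrinks no subspace is full and  *)
(*   becomes invertible over the free skew field; a linear matrix shrinking   *)
(*   subspaces by at most s has such a square submatrix of corank s.          *)
(* - So every cd-shrunk X contains K and has Bl(X) = A(X).  Apply this to the *)
(*   subrepresentation T spanned by the translates W(p) u of the components u *)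
(*   of a maximally shrunk subspace: its domain part X_T is cd-shrunk, its    *)
(*   codomain part is Y_T = Bl(X_T), and B(Y_T) <= X_T since K <= X_T.  Thus  *)
(*   T is a subrepresentation of W^+ above K, so W' <= T, whence              *)
(*   Y_W' <= im A, and y = A(B y) for y in Y_W' gives Y_W' = A(X_W').         *)
Require Import Defs.
From HB Require Import structures.
From mathcomp Require Import all_boot all_order all_algebra.
From mathcomp Require Import boolp finmap.
From mathcomp.multinomials Require Import monalg.
From mathcomp Require Import zify.

Set Implicit Arguments.
Unset Strict Implicit.
Unset Printing Implicit Defensive.

Import Order.TTheory GRing.Theory Num.Theory passmx.
Local Open Scope ring_scope.

(** Write X_T and Y_T for the sums of the copies of the T(x) in the domain and the codomain of the
    blow-up Bl ([blowup_sub] for [wpos] and [wneg]). Subrepresentations correspond to shrunk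
    subspaces: Bl(X_T) lies in Y_T for a subrepresentation T ([matrix_space_blowup_sub]), d times
    its weight is dim X_T - dim Y_T ([weight_dimE]), and closing a subspace under paths does not
    enlarge its image ([path_closure_image]). So d times a weight is at most cd, and some T attains
    this.

    The rank of A enters through dim ker A <= cd, by [ncrk_ge]. For a cd-shrunk subspace this makes
    every estimate in [shrunk_lker] an equality. By [kernel_part_subP] and [subrep_plusP], W' is the
    least subrepresentation T of W with ker A <= X_T and B(Y_T) <= X_T. An extremal T satisfies
    both, so W' <= T and Y_W' lies in im A, where A B is the identity. Hence A maps X_W' onto Y_W',
    with kernel ker A of dimension cd. *)

(** * Shrunk subspaces of matrix tuples and the choice of a square subtuple *)

Definition mx_image (F : fieldType) (m n q p : nat) (C : 'I_m -> 'M[F]_(q, p))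
    (U : 'M[F]_(n, q)) : 'M[F]_p :=
  (\sum_k <<U *m C k>>)%MS.

Lemma mx_image_subP (F : fieldType) (m n q p l : nat)
    (C : 'I_m -> 'M[F]_(q, p)) (U : 'M[F]_(n, q)) (V : 'M[F]_(l, p)) :
  reflect (forall k, (U *m C k <= V)%MS) (mx_image C U <= V)%MS.
Proof.
apply: (iffP sumsmx_subP) => H k; first by rewrite -genmxE H.
by rewrite genmxE.
Qed.

Lemma mx_image_sub (F : fieldType) (m n q p : nat)
    (C : 'I_m -> 'M[F]_(q, p)) (U : 'M[F]_(n, q)) (k : 'I_m) :
  (U *m C k <= mx_image C U)%MS.
Proof. by move: k; apply/mx_image_subP. Qed.

Lemma mx_imageS (F : fieldType) (m n l q p : nat) (C : 'I_m -> 'M[F]_(q, p))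
    (U : 'M[F]_(n, q)) (V : 'M[F]_(l, q)) :
  (U <= V)%MS -> (mx_image C U <= mx_image C V)%MS.
Proof.
move=> UV; apply/mx_image_subP => k.
exact: submx_trans (submxMr _ UV) (mx_image_sub _ _ _).
Qed.

Lemma mx_image_adds (F : fieldType) (m n l q p : nat)
    (C : 'I_m -> 'M[F]_(q, p)) (U : 'M[F]_(n, q)) (V : 'M[F]_(l, q)) :
  (mx_image C (U + V)%MS <= mx_image C U + mx_image C V)%MS.
Proof.
apply/mx_image_subP => k; rewrite addsmxMr.
by apply: addsmxS; exact: mx_image_sub.
Qed.

(** Submodularity makes the extremal subspaces a lattice: those of maximal shrinking are closed
    under sum and intersection. Both selections below rest on this. *)
Lemma mx_image_submodular (F : fieldType) (m n l q p : nat)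
    (C : 'I_m -> 'M[F]_(q, p)) (U : 'M[F]_(n, q)) (V : 'M[F]_(l, q)) :
  (\rank (mx_image C (U + V)%MS) + \rank (mx_image C (U :&: V)%MS)
     <= \rank (mx_image C U) + \rank (mx_image C V))%N.
Proof.
rewrite -(mxrank_sum_cap (mx_image C U)) leq_add //; apply: mxrankS.
  exact: mx_image_adds.
by rewrite sub_capmx !mx_imageS ?capmxSl ?capmxSr.
Qed.

Lemma mx_image_mulmx (F : fieldType) (m n l q p : nat)
    (C : 'I_m -> 'M[F]_(q, p)) (U : 'M[F]_(n, l)) (E : 'M[F]_(l, q)) :
  mx_image (fun k => E *m C k) U = mx_image C (U *m E).
Proof. by apply: eq_bigr => k _; rewrite mulmxA. Qed.

Lemma mx_imageMr (F : fieldType) (m n l q p : nat)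
    (C : 'I_m -> 'M[F]_(q, p)) (U : 'M[F]_(n, q)) (E : 'M[F]_(p, l)) :
  (mx_image C U *m E :=: mx_image (fun k => C k *m E) U)%MS.
Proof.
apply/eqmxP/andP; split; last first.
  by apply/mx_image_subP => k; rewrite mulmxA submxMr ?mx_image_sub.
rewrite /mx_image sumsmxMr_gen; apply/sumsmx_subP => k _.
by rewrite genmxE (eqmxMr _ (genmxE _)) -mulmxA mx_image_sub.
Qed.

Definition mx_shrink_le (F : fieldType) (m q p : nat) (s : nat)
    (C : 'I_m -> 'M[F]_(q, p)) : Prop :=
  forall n (U : 'M[F]_(n, q)), (\rank U <= \rank (mx_image C U) + s)%N.

(* The maximally shrunk subspaces are closed under intersection, so there is  *)
(* a least one; deleting a coordinate on which it does not vanish destroys    *)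
(* all of them.                                                               *)
Lemma delete_shrunk_coordinate (F : fieldType) (m q p s : nat)
    (C : 'I_m -> 'M[F]_(q.+1, p)) :
  mx_shrink_le s.+1 C -> ~ mx_shrink_le s C ->
  exists j, mx_shrink_le s (fun k => row' j (C k)).
Proof.
move=> Cs1 Cs.
pose P (r : nat) := `[< exists2 U : 'M[F]_q.+1,
  \rank U = r & \rank U = (\rank (mx_image C U) + s.+1)%N >].
have mkP n (U : 'M[F]_(n, q.+1)) :
    (\rank (mx_image C U) + s < \rank U)%N -> P (\rank U).
  move=> lt; apply/asboolP; exists <<U>>%MS; rewrite ?genmxE //.
  have -> : \rank (mx_image C <<U>>%MS) = \rank (mx_image C U).
    by apply/eqmx_rank/andP; rewrite !mx_imageS ?genmxE.
  by apply/eqP; rewrite eqn_leq Cs1 addnS.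
have exP : exists r, P r.
  apply: contrapT => nP; apply: Cs => n U; rewrite leqNgt; apply/negP => lt.
  by apply: nP; exists (\rank U); exact: mkP.
case: (ex_minnP exP) => r0 /asboolP [U0 rU0 tU0] min_r0.
have /row_subPn/= : ~~ (U0 <= (0 : 'M[F]_q.+1))%MS.
  by rewrite submx0 -mxrank_eq0 tU0 addnS.
case=> i; rewrite submx0 => /eqP Ui.
have [j Uij] : exists j, U0 i j != 0.
  apply: contrapT => nj; apply: Ui; apply/rowP => j; rewrite !mxE.
  by apply/eqP/negPn/negP => Uij; apply: nj; exists j.
exists j => n U; rewrite leqNgt; apply/negP => lt.
(* [E] embeds the shorter rows as the hyperplane where coordinate [j] vanishes, so a subspace shrunk
   after the deletion is one shrunk before it, inside this hyperplane. *)
pose E : 'M[F]_(q, q.+1) := rowsub (lift j) 1%:M.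
have CE k : row' j (C k) = E *m C k.
  by rewrite -rowsubE; apply/matrixP => a b; rewrite !mxE.
have Efree : row_free E.
  apply/row_freeP; exists (colsub (lift j) 1%:M).
  rewrite /E -rowsubE; apply/matrixP => a b; rewrite !mxE.
  by rewrite (inj_eq lift_inj).
pose U1 := U *m E.
have rU1 : \rank U1 = \rank U by rewrite mxrankMfree.
have tU1 : (\rank (mx_image C U1) + s < \rank U1)%N.
  rewrite rU1; move: lt.
  rewrite (_ : mx_image _ U = mx_image C U1) // -mx_image_mulmx.
  by apply: eq_bigr => k _; rewrite CE.
(* The intersection is again extremal, so minimality of [U0] forces it to be all of [U0]; but [U0]
   does not lie in the hyperplane. *)
have U0U1 : (U0 <= U1)%MS.
  have : P (\rank (U0 :&: U1)%MS).
    apply: mkP.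
    have := mx_image_submodular C U0 U1.
    have := mxrank_sum_cap U0 U1; have := Cs1 _ (U0 + U1)%MS.
    by move: tU1; rewrite tU0; lia.
  move/min_r0; rewrite -rU0 => le.
  apply: submx_trans (capmxSr U0 _).
  by rewrite -(geq_leqif (mxrank_leqif_sup (capmxSl _ _))).
move/submxP: U0U1 => [D DE]; move/eqP: Uij; apply.
rewrite DE mulmxA mxE big1 // => a _; rewrite !mxE.
by rewrite eq_sym (negbTE (neq_lift j a)) mulr0.
Qed.

(** Each deletion of a coordinate lowers the maximal shrinking by one, so [s] deletions are enough.
    Tuples act on row vectors: rows of [C k] are columns of the linear matrix. *)
Lemma select_columns (F : fieldType) (m p s q : nat)
    (C : 'I_m -> 'M[F]_(q, p)) :
  mx_shrink_le s C ->
  exists r (f : 'I_r -> 'I_q), [/\ (q <= r + s)%N, injective f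
    & mx_shrink_le 0 (fun k => rowsub f (C k))].
Proof.
elim: s q C => [|s IH] q C Cs.
  exists q, id; split; rewrite ?addn0 //.
  by move=> n U; rewrite (_ : mx_image _ U = mx_image C U) ?Cs //;
    apply: eq_bigr => k _; congr (<<_ *m _>>)%MS;
    apply/matrixP => a b; rewrite mxE.
have [{}Cs|nCs] := pselect (mx_shrink_le s C).
  by have [r [f [le fi Cf]]] := IH _ _ Cs; exists r, f; split=> //; lia.
case: q C Cs nCs => [|q] C Cs nCs.
  by case: nCs => n U; rewrite (leq_trans (rank_leq_col U)).
have [j /IH [r [f [le fi Cf]]]] := delete_shrunk_coordinate Cs nCs.
exists r, (lift j \o f); split; first by lia.
  exact: inj_comp lift_inj fi.
move=> n U; rewrite (_ : mx_image _ U =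
  mx_image (fun k => rowsub f (row' j (C k))) U) ?Cf //.
by apply: eq_bigr => k _; congr (<<_ *m _>>)%MS;
  apply/matrixP => a b; rewrite !mxE.
Qed.

(* Dually, the subspaces U with dim C(U) = dim U are closed under sums, and   *)
(* the image of the greatest one is too small to contain every basis vector.  *)
Lemma select_rows (F : fieldType) (m r p : nat) (C : 'I_m -> 'M[F]_(r, p)) :
  mx_shrink_le 0 C ->
  exists2 g : 'I_r -> 'I_p, injective g
    & mx_shrink_le 0 (fun k => colsub g (C k)).
Proof.
elim: p C => [|p IH] C C0.
  suff r0 : r = 0%N.
    by move: C C0; rewrite r0 => C C0; exists id => // n U;
      rewrite thinmx0 mxrank0.
  apply/eqP; rewrite -leqn0.
  have := C0 _ (1%:M : 'M_r); rewrite mxrank1 addn0 => /leq_trans; apply.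
  exact: rank_leq_col.
have rp : (r <= p.+1)%N.
  have := C0 _ (1%:M : 'M_r); rewrite mxrank1 addn0 => /leq_trans; apply.
  exact: rank_leq_col.
move: rp; rewrite leq_eqVlt => /predU1P [rp|rp].
  move: C C0; rewrite -rp => C C0; exists id => // n U.
  by rewrite (_ : mx_image _ U = mx_image C U) ?C0 //;
    apply: eq_bigr => k _; congr (<<_ *m _>>)%MS;
    apply/matrixP => a b; rewrite mxE.
pose P (x : nat) := `[< exists2 U : 'M[F]_r,
  \rank U = x & \rank (mx_image C U) = x >].
have P0 : exists x, P x.
  exists 0%N; apply/asboolP; exists 0; rewrite ?mxrank0 //; apply/eqP.
  rewrite mxrank_eq0 -submx0; apply/mx_image_subP => k.
  by rewrite mul0mx sub0mx.
have Pub x : P x -> (x <= r)%N.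
  by move/asboolP => [U <- _]; exact: rank_leq_row.
case: (ex_maxnP P0 Pub) => x /asboolP [U0 rU0 tU0] max_x.
(* The image of [U0] has dimension at most [r], which is below [p.+1], so it misses a basis vector;
   that coordinate is the one to delete. *)
have [i ni] : exists i, ~~ ((delta_mx ord0 i : 'rV_p.+1) <= mx_image C U0)%MS.
  apply: contrapT => H.
  have : (p.+1 <= \rank (mx_image C U0))%N.
    rewrite -{1}(mxrank1 F p.+1); apply/mxrankS/row_subP => i.
    by rewrite row1; apply: contrapT => Hi; apply: H; exists i; apply/negP.
  by rewrite tU0 -rU0; have := rank_leq_row U0; lia.
have [|g gi Cg] := IH (fun k => col' i (C k)); last first.
  exists (lift i \o g); first by move=> a b /= /lift_inj /gi.
  move=> n U; rewrite (_ : mx_image _ U =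
    mx_image (fun k => colsub g (col' i (C k))) U) ?Cg //.
  by apply: eq_bigr => k _; congr (<<_ *m _>>)%MS;
  apply/matrixP => a b; rewrite !mxE.
move=> n U; rewrite addn0 leqNgt; apply/negP => lt.
pose E : 'M[F]_(p.+1, p) := colsub (lift i) 1%:M.
have imE : \rank (mx_image (fun k => col' i (C k) : 'M_(r, p)) U) =
    \rank (mx_image C U *m E).
  rewrite (mx_imageMr C U E); congr (\rank _); apply: eq_bigr => k _.
  congr (<<_ *m _>>)%MS; rewrite mulmx_colsub mulmx1.
  by apply/matrixP => a b; rewrite !mxE.
have kerE : (kermx E <= (delta_mx ord0 i : 'rV_p.+1))%MS.
  apply/row_subP => a; have := mulmx_ker E.
  move/(congr1 (row a)); rewrite row_mul row0 => aE.
  apply/sub_rVP; exists (kermx E a i); apply/rowP => b; rewrite !mxE eqxx /=.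
  have [->|nbi] := eqVneq b i; first by rewrite mulr1.
  have [b' ->] : exists b', b = lift i b'.
    by move: nbi; rewrite eq_sym => /unlift_some [b' -> _]; exists b'.
  have := congr1 (fun M : 'rV_p => M 0 b') aE.
  by rewrite mulmx_colsub mulmx1 !mxE mulr0.
have := mxrank_mul_ker (mx_image C U) E; rewrite -imE => rk.
have CU := C0 _ U; rewrite addn0 in CU.
have dK : ((mx_image C U :&: kermx E)%MS <= (delta_mx ord0 i : 'rV_p.+1))%MS.
  exact: submx_trans (capmxSr _ _) kerE.
have rk1 : (\rank (mx_image C U :&: kermx E)%MS <= 1)%N.
  by have := mxrankS dK; rewrite mxrank_delta.
(* Forgetting coordinate [i] kills only the line of the [i]-th basis vector. If [U] becomes shrunk,
   then its image had dimension exactly dim [U] and contained that line. *)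
have tU : \rank (mx_image C U) = \rank U.
  by lia.
have dU : ((delta_mx ord0 i : 'rV_p.+1) <= mx_image C U)%MS.
  apply: submx_trans (capmxSl _ (kermx E)).
  by rewrite -(geq_leqif (mxrank_leqif_sup dK)) mxrank_delta; lia.
have : P (\rank (U0 + U)%MS).
  apply/asboolP; exists (U0 + U)%MS => //.
  have := mx_image_submodular C U0 U; have := mxrank_sum_cap U0 U.
  have := C0 _ (U0 + U)%MS; have := C0 _ (U0 :&: U)%MS; lia.
move/max_x; rewrite -rU0 => le.
have sub : (U0 + U <= U0)%MS.
  by rewrite -(geq_leqif (mxrank_leqif_sup (addsmxSl _ _))).
move/negP: ni; apply; apply: (submx_trans dU); apply: mx_imageS.
exact: submx_trans (addsmxSr _ _) sub.
Qed.

(** * Full linear matrices over the free algebra, and rank over a skew field *)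

Lemma sum_delta (R : nmodType) (K : eqType) (s : seq K) (k : K) (f : K -> R) :
  uniq s -> k \in s -> \sum_(i <- s) f i *+ (i == k) = f k.
Proof.
move=> us ks; rewrite (bigD1_seq k) //= eqxx mulr1n big1 ?addr0 //.
by move=> i /negbTE ->; rewrite mulr0n.
Qed.

(** A word of length one factors only as itself times the empty word, on either side. *)
Lemma mcoeff_mul_fmu (F : fieldType) (I : choiceType)
    (a b : {malg F[{fmonom I}]}) (i : I) :
  (a * b)@_(fmu i) = a@_(fmu i) * b@_(fmone I) + a@_(fmone I) * b@_(fmu i).
Proof.
set x := fmu i; pose e := fmone I.
have ex : e != x by rewrite -val_eqE /= fm1 fmU.
(* The supports are padded by 1 and x so that the two relevant terms occur in the sums even when
   their coefficients vanish. *)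
pose d (c : {malg F[{fmonom I}]}) : {fset {fmonom I}} :=
  (msupp c `|` [fset e; x])%fset.
have ed c : e \in d c by rewrite !inE eqxx orbT.
have xd c : x \in d c by rewrite !inE eqxx !orbT.
rewrite (mcoeffMlw (d1 := d a) (d2 := d b)) ?fsubsetUl //.
pose f1 k1 := \sum_(k2 <- d b) (a@_k1 * b@_k2) *+ (k2 == e).
pose f2 k1 := \sum_(k2 <- d b) (a@_k1 * b@_k2) *+ (k2 == x).
transitivity (\sum_(k1 <- d a) (f1 k1 *+ (k1 == x) + f2 k1 *+ (k1 == e))).
  apply: eq_bigr => k1 _; rewrite -!sumrMnl -big_split /=.
  apply: eq_bigr => k2 _; rewrite -!mulrnA -mulrnDr; congr (_ *+ _).
  rewrite !mulnb -!val_eqE /= fmM fmU fm1.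
  case: k1 k2 => [[|y1 s1]] [[|y2 s2]] //=.
  - by rewrite add0n eqxx andbT.
  - by rewrite cats0 addn0.
  - by rewrite andbF eqseq_cons; case: s1 => [|? ?]; rewrite andbF.
rewrite big_split /= !sum_delta ?fset_uniq ?ed ?xd //.
by rewrite /f1 /f2 !sum_delta ?fset_uniq ?ed ?xd.
Qed.

Lemma mcoeff_mul_1 (F : fieldType) (I : choiceType)
    (a b : {malg F[{fmonom I}]}) :
  (a * b)@_(fmone I) = a@_(fmone I) * b@_(fmone I).
Proof. exact: (rmorphM (mcoeff (mone : {fmonom I}))). Qed.

(** For a factorization through size [l], the kernel of [Q0] has dimension r - rk Q0 and its image
    lies in that of [P0], where rk P0 <= l - rk Q0 because P0 Q0 = 0. No shrinking then gives r <=
    l. The transposed indices of [C k] pass from row vectors to columns. *)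
Lemma linear_matrix_full (F : fieldType) (m r : nat) (C : 'I_m -> 'M[F]_r)
    (M : 'M[free_alg F 'I_m]_r) :
  (forall i j, M i j = \sum_k C k j i *: free_var F k) ->
  mx_shrink_le 0 C -> full_mx M.
Proof.
move=> ME C0 l P Q MPQ; rewrite leqNgt; apply/negP => lr.
pose co x (a b : nat) (N : 'M[free_alg F 'I_m]_(a, b)) : 'M[F]_(a, b) :=
  \matrix_(i, j) (N i j : {malg F[{fmonom 'I_m}]})@_x.
have co1 : co (fmone 'I_m) _ _ P *m co (fmone 'I_m) _ _ Q = 0.
  apply/matrixP => i j.
  have := congr1 (fun N : 'M[free_alg F 'I_m]_r =>
    (N i j : {malg F[{fmonom 'I_m}]})@_(fmone 'I_m)) MPQ.
  rewrite ME !mxE raddf_sum big1 => [H|k _]; last first.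
    by rewrite /= mcoeffZ mcoeffU1 -val_eqE /= fm1 fmU mulr0.
  rewrite [RHS]H raddf_sum; apply: eq_bigr => k _.
  by rewrite !mxE /= mcoeff_mul_1.
have coU k : (C k)^T = co (fmu k) _ _ P *m co (fmone 'I_m) _ _ Q
    + co (fmone 'I_m) _ _ P *m co (fmu k) _ _ Q.
  apply/matrixP => i j.
  have := congr1 (fun N : 'M[free_alg F 'I_m]_r =>
    (N i j : {malg F[{fmonom 'I_m}]})@_(fmu k)) MPQ.
  rewrite ME !mxE !raddf_sum (bigD1 k) //= big1 => [|k' nk]; last first.
    rewrite mcoeffZ mcoeffU1 -val_eqE /= !fmU eqseq_cons andbT.
    by rewrite (negbTE nk) mulr0.
  rewrite addr0 mcoeffZ mcoeffU1 eqxx mulr1 => ->.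
  rewrite -big_split; apply: eq_bigr => l' _.
  by rewrite !mxE /= mcoeff_mul_fmu.
set P0 := co (fmone 'I_m) _ _ P in co1 coU.
set Q0 := co (fmone 'I_m) _ _ Q in co1 coU.
have := C0 _ (kermx Q0^T); rewrite mxrank_ker addn0 mxrank_tr.
have : (mx_image C (kermx Q0^T) <= P0^T)%MS.
  apply/mx_image_subP => k; rewrite -[C k]trmxK coU linearD /= !trmx_mul.
  by rewrite mulmxDr mulmxA mulmx_ker mul0mx add0r mulmxA submxMl.
move/mxrankS; rewrite mxrank_tr.
have := mulmx0_rank_max co1; have := rank_leq_col Q0; lia.
Qed.

(** The columns chosen by [f] are right independent: a relation among them, restricted to the rows
    chosen by [g], is killed by the left inverse of the submatrix. *)
Lemma skew_rank_submx (D : nzRingType) (p q r : nat) (M : 'M[D]_(p, q))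
    (g : 'I_r -> 'I_p) (f : 'I_r -> 'I_q) :
  injective f -> inv_mx (mxsub g f M) -> (r <= skew_rank M)%N.
Proof.
move=> fi [N [_ NM]]; rewrite /skew_rank.
pose J := [set f b | b : 'I_r].
have <- : #|J| = r by rewrite card_imset // card_ord.
apply: leq_bigmax_cond; apply/asboolP => v vJ Mv.
pose w : 'cV[D]_r := rowsub f v.
have w0 : w = 0.
  rewrite -[w]mul1mx -NM -mulmxA (_ : _ *m w = 0) ?mulmx0 //.
  apply/matrixP => a b; rewrite !mxE.
  have := congr1 (fun u : 'cV[D]_p => u (g a) b) Mv; rewrite !mxE => Mvab.
  rewrite -{}[RHS]Mvab [RHS](bigID [in J]) /= [X in _ + X]big1 ?addr0.
    rewrite /J big_imset /=; last by move=> ? ? _ _ /fi.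
    by apply: eq_bigr => i _; rewrite !mxE.
  by move=> j nj; rewrite ord1 vJ ?mulr0.
apply/matrixP => a b; rewrite ord1 !mxE.
have [/imsetP [c _ ->]|/vJ //] := boolP (a \in J).
by have := congr1 (fun u : 'cV[D]_r => u c 0) w0; rewrite !mxE.
Qed.

(** * Subspaces in coordinates and the lower bound for the non-commutative rank *)

Lemma lin_span_subP (F : fieldType) (V : vectType F) (S : V -> Prop)
    (U : {vspace V}) :
  (forall v, S v -> v \in U) <-> (lin_span S <= U)%VS.
Proof.
split=> [SU|/subvP SU v Sv]; last first.
  apply/SU/lin_spanP; exists 1%N, (fun=> 1), (fun=> v).
  by rewrite big_ord1 scale1r.
apply/subvP => v /lin_spanP [n [a [u [Su ->]]]].
by apply: memv_suml => i _; apply/memvZ/SU.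
Qed.

Lemma mem_lin_span (F : fieldType) (V : vectType F) (S : V -> Prop) (v : V) :
  S v -> v \in lin_span S.
Proof. by move: v; apply/lin_span_subP; exact: subvv. Qed.

Lemma space_image_subP (F : fieldType) (V V' : vectType F)
    (B : {vspace 'Hom(V, V')}) (U : {vspace V}) (X : {vspace V'}) :
  (forall M u, M \in B -> u \in U -> M u \in X) <-> (space_image B U <= X)%VS.
Proof.
rewrite -lin_span_subP; split=> [H v [M [u [MB uU ->]]]|H M u MB uU].
  exact: H.
by apply: H; exists M, u.
Qed.

Lemma mem_space_image (F : fieldType) (V V' : vectType F)
    (B : {vspace 'Hom(V, V')}) (U : {vspace V}) (M : 'Hom(V, V')) (u : V) :
  M \in B -> u \in U -> M u \in space_image B U.
Proof. by move: M u; apply/space_image_subP; exact: subvv. Qed.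

Lemma space_imageS (F : fieldType) (V V' : vectType F)
    (B : {vspace 'Hom(V, V')}) (U X : {vspace V}) :
  (U <= X)%VS -> (space_image B U <= space_image B X)%VS.
Proof.
move=> /subvP UX; apply/space_image_subP => M u MB /UX.
exact: mem_space_image.
Qed.

(** A row base of [M] yields free vectors. This and the next lemma are the two comparisons that
    carry a shrinking bound from subspaces over to matrices. *)
Lemma mxrank_le_dim_vsof (F : fieldType) (V : vectType F)
    (e : (\dim {:V}).-tuple V) (M : 'M[F]_(\dim {:V})) :
  basis_of {:V} e -> (\rank M <= \dim (vsof e M))%N.
Proof.
move=> eb; pose X := [tuple vecof e (row i (row_base M)) | i < \rank M].
have fX : free X.
  apply/freeP => k k0; have kr : \row_i k i *m row_base M = 0.
    apply/eqP; rewrite -(vecof_eq0 (e := e)) ?(basis_free eb) //.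
    rewrite mulmx_sum_row linear_sum /=; apply/eqP; rewrite -[RHS]k0.
    apply: eq_bigr => i _; rewrite linearZ /= mxE; congr (_ *: _).
    by rewrite -[RHS](tnth_nth 0 X i) tnth_mktuple.
  move=> i; have : \row_i k i = 0.
    by apply/eqP; rewrite -(mulmx_free_eq0 _ (row_base_free M)) kr.
  by move/rowP/(_ i); rewrite !mxE.
have -> : \rank M = \dim <<X>> by rewrite (eqnP fX) size_tuple.
apply/dimvS/span_subvP => v /tnthP [i ->]; rewrite tnth_mktuple.
rewrite -rVof_sub // vecofK ?(basis_free eb) //.
by rewrite (submx_trans (row_sub _ _)) // eq_row_base.
Qed.

Lemma dim_le_mxrank_msof (F : fieldType) (V : vectType F)
    (e : (\dim {:V}).-tuple V) (U : {vspace V}) :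
  basis_of {:V} e -> (\dim U <= \rank (msof e U))%N.
Proof.
move=> eb; pose M := \matrix_(i < \dim U) rVof e (vbasis U)`_i.
have fM : row_free M.
  rewrite -kermx_eq0; apply/eqP/row_matrixP => a; rewrite row0.
  set u := row a _; have uM : u *m M = 0.
    by rewrite /u -row_mul mulmx_ker row0.
  apply/rowP => i; rewrite [RHS]mxE.
  have /freeP/(_ (fun j => u 0 j)) H := basis_free (vbasisP U).
  move: i; apply: H.
  apply/eqP; rewrite -(rVof_eq0 (e := e)) ?eb // linear_sum /=.
  apply/eqP; rewrite -[RHS]uM mulmx_sum_row; apply: eq_bigr => j _.
  by rewrite linearZ /= rowK.
rewrite -{1}(eqP fM); apply/mxrankS/row_subP => i; rewrite rowK -mem_vecof //.
by rewrite rVofK // vbasis_mem // mem_nth ?size_tuple.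
Qed.

(** In coordinates, deleting at most [s] columns and then suitable rows leaves a square tuple that
    shrinks nothing. Its generic matrix is full, hence invertible over the free skew field, and its
    size bounds the rank from below. *)
Lemma ncrk_ge (F : fieldType) (V V' : vectType F) (B : {vspace 'Hom(V, V')})
    (r s : nat) :
  is_ncrk B r ->
  (forall U : {vspace V}, (\dim U <= \dim (space_image B U) + s)%N) ->
  (\dim {:V} <= r + s)%N.
Proof.
move=> [m [Bs [D [iota [spanB fsf ->]]]]] Bsh.
set e := vbasis {:V}; set e' := vbasis {:V'}.
have eb : basis_of {:V} e := vbasisP _.
have eb' : basis_of {:V'} e' := vbasisP _.
pose C (k : 'I_m) := mxof e e' (tnth Bs k).
have Cs : mx_shrink_le s C.
  move=> n U; rewrite -(genmxE U).
  apply: leq_trans (mxrank_le_dim_vsof _ eb) _.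
  apply: leq_trans (Bsh _) _; rewrite leq_add2r.
  apply: leq_trans (dim_le_mxrank_msof _ eb') _; apply: mxrankS.
  rewrite msof_sub //; apply/space_image_subP => M u MB uU.
  suff : (M \in <<Bs>>)%VS -> (rVof e' (M u) <= mx_image C U)%MS.
    by rewrite spanB => /(_ MB); rewrite rVof_sub.
  move: uU; rewrite -rVof_sub // genmxE => uU.
  move=> /coord_span ->; rewrite sum_lfunE linear_sum /=.
  apply: summx_sub => k _; rewrite scale_lfunE linearZ /=; apply: scalemx_sub.
  rewrite (rVof_app e' eb) -(tnth_nth 0 Bs k).
  exact: submx_trans (submxMr _ uU) (mx_image_sub C U k).
have [r' [f [qr fi Cf]]] := select_columns Cs.
have [g gi Cgf] := select_rows Cf.
apply: leq_trans qr _; rewrite leq_add2r.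
apply: (@skew_rank_submx _ _ _ _ _ g f fi).
rewrite -map_mxsub; apply: (fsf_inverts fsf).
apply: (linear_matrix_full _ Cgf) => i j; rewrite !mxE.
apply: eq_bigr => k _; congr (_ *: _); rewrite !mxE /=.
by rewrite vecof_delta.
Qed.

(** * Blow-ups, their shrunk subspaces, and pseudo-inverses *)

Lemma lin_span_apply (F : fieldType) (V V' : vectType F)
    (S : 'Hom(V, V') -> Prop) (X : {vspace V'}) (M : 'Hom(V, V')) (u : V) :
  (forall N, S N -> N u \in X) -> M \in lin_span S -> M u \in X.
Proof.
move=> SX /lin_spanP [n [a [N [SN ->]]]]; rewrite sum_lfunE.
by apply: memv_suml => i _; rewrite scale_lfunE; apply/memvZ/SX.
Qed.

Lemma mem_capv_preim (F : fieldType) (V : vectType F) (I : finType)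
    (Vs : I -> vectType F) (p : forall i, 'Hom(V, Vs i))
    (T : forall i, {vspace Vs i}) (v : V) :
  (v \in \bigcap_i (p i @^-1: T i))%VS <-> (forall i, p i v \in T i).
Proof.
rewrite memvE; split=> [/subv_bigcapP H i|H].
  by rewrite memv_preim memvE H.
by apply/subv_bigcapP => i _; rewrite -memvE -memv_preim.
Qed.

(** The maps [p] and [q] present V as a direct sum, and the intersection is the sum of the embedded
    [T i]. This serves both for d-th powers and for copies of the W(x). *)
Lemma dim_capv_preim (F : fieldType) (V : vectType F) (I : finType)
    (Vs : I -> vectType F) (p : forall i, 'Hom(V, Vs i))
    (q : forall i, 'Hom(Vs i, V)) (T : forall i, {vspace Vs i}) :
  (forall i w, p i (q i w) = w) ->
  (forall i j w, i != j -> p j (q i w) = 0) ->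
  (forall v, \sum_i q i (p i v) = v) ->
  \dim (\bigcap_i (p i @^-1: T i))%VS = (\sum_i \dim (T i))%N.
Proof.
move=> pq pq0 qp.
have -> : (\bigcap_i (p i @^-1: T i))%VS = (\sum_i (q i @: T i))%VS.
  apply/vspaceP => v; apply/idP/idP => [/mem_capv_preim H|/memv_sumP].
    rewrite -(qp v); apply: memv_sumr => i _. exact: memv_img (H i).
  case=> vs vsq ->; apply/mem_capv_preim => j; rewrite linear_sum /=.
  apply: memv_suml => i _; have /memv_imgP [w wT ->] := vsq i isT.
  have [ij|/pq0 ->] := eqVneq i j; last exact: mem0v.
  by case: j / ij; rewrite pq.
have dx : directv (\sum_i (q i @: T i)).
  apply/directv_sum_independent => us usq us0 j _.
  have /memv_imgP [w wT Ew] := usq j isT; rewrite Ew.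
  have := congr1 (p j) us0; rewrite linear0 linear_sum (bigD1 j) //= big1.
    by rewrite addr0 Ew pq => ->; rewrite linear0.
  by move=> i nij; have /memv_imgP [x _ ->] := usq i isT; rewrite pq0.
rewrite (directvP dx) /=; apply: eq_bigr => i _; apply: limg_dim_eq.
apply/eqP; rewrite -subv0; apply/subvP => w; rewrite memv_cap memv0 memv_ker.
by case/andP => _ /eqP qw; rewrite -(pq i w) qw linear0.
Qed.

Definition pow_space (F : fieldType) (d : nat) (V : vectType F)
    (U : {vspace V}) : {vspace {ffun 'I_d -> V}} :=
  (\bigcap_(k < d) (pow_proj V k @^-1: U))%VS.

Lemma mem_pow_space (F : fieldType) (d : nat) (V : vectType F)
    (U : {vspace V}) (u : {ffun 'I_d -> V}) :
  u \in pow_space d U <-> (forall k, u k \in U).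
Proof.
rewrite (mem_capv_preim (fun k => pow_proj V k) (fun=> U)).
by split=> H k; have := H k; rewrite pow_projE.
Qed.

Lemma pow_inj_sum (F : fieldType) (d : nat) (V : vectType F)
    (u : {ffun 'I_d -> V}) : \sum_k pow_inj V k (u k) = u.
Proof.
apply/ffunP => l; rewrite sum_ffunE (bigD1 l) //= pow_injE ffunE eqxx.
rewrite big1 ?addr0 // => k nkl.
by rewrite pow_injE ffunE eq_sym (negbTE nkl).
Qed.

Lemma dim_pow_space (F : fieldType) (d : nat) (V : vectType F)
    (U : {vspace V}) : \dim (pow_space d U) = (\dim U * d)%N.
Proof.
rewrite /pow_space (dim_capv_preim (q := fun k => pow_inj V k) (fun=> U)).
- by rewrite sum_nat_const card_ord mulnC.
- by move=> k w; rewrite pow_projE pow_injE ffunE eqxx.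
- by move=> k l w nkl; rewrite pow_projE pow_injE ffunE eq_sym (negbTE nkl).
- move=> v; rewrite -[RHS]pow_inj_sum.
  by apply: eq_bigr => k _; rewrite pow_projE.
Qed.

Lemma mem_kron_blowup (F : fieldType) (d : nat) (V V' : vectType F)
    (B : {vspace 'Hom(V, V')}) (E : 'M[F]_d) (M : 'Hom(V, V')) :
  M \in B -> kron E M \in blowup d B.
Proof. by move=> MB; apply: mem_lin_span; exists E, M. Qed.

Lemma kron_delta (F : fieldType) (d : nat) (V V' : vectType F)
    (M : 'Hom(V, V')) (k l : 'I_d) (u : {ffun 'I_d -> V}) :
  kron (delta_mx k l) M u = pow_inj V' k (M (u l)).
Proof.
apply/ffunP => a; rewrite kronE pow_injE !ffunE (bigD1 l) //= big1.
  by rewrite addr0 mxE eqxx andbT; case: eqP; rewrite (scale1r, scale0r).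
by move=> b nb; rewrite mxE (negbTE nb) andbF scale0r.
Qed.

(** Tensoring with the matrix units moves any component of a vector to any position, so the image
    depends only on the sum of the components of X. *)
Lemma space_image_blowup (F : fieldType) (d : nat) (V V' : vectType F)
    (B : {vspace 'Hom(V, V')}) (X : {vspace {ffun 'I_d -> V}}) :
  space_image (blowup d B) X =
    pow_space d (space_image B (\sum_(k < d) (pow_proj V k @: X))%VS).
Proof.
apply: subv_anti; apply/andP; split.
  apply/space_image_subP => N u NB uX; move: NB; apply: lin_span_apply.
  move=> _ [E [M [MB ->]]]; apply/mem_pow_space => k; rewrite kronE ffunE.
  apply: memv_suml => l _; apply/memvZ/mem_space_image => //.
  rewrite (subvP (sumv_sup l isT (subvv _))) // -pow_projE.
  exact: memv_img.
apply/subvP => w /mem_pow_space wB; rewrite -(pow_inj_sum w).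
apply: memv_suml => k _; rewrite memv_preim; move: (wB k); apply/subvP.
apply/space_image_subP => M u MB uX; rewrite -memv_preim.
have -> : pow_inj V' k (M u) = (pow_inj V' k \o M)%VF u by rewrite comp_lfunE.
rewrite memv_preim; move: uX; apply/subvP/subv_sumP => l _.
apply/subvP => _ /memv_imgP [v vX ->]; rewrite -memv_preim comp_lfunE.
rewrite pow_projE -kron_delta; apply: mem_space_image => //.
exact: mem_kron_blowup.
Qed.

(** X lies in the d-th power of the sum of its components, which has the same image, and there all
    dimensions are multiplied by d. *)
Lemma blowup_shrink_le (F : fieldType) (d c : nat) (V V' : vectType F)
    (B : {vspace 'Hom(V, V')}) :
  (forall U, (\dim U <= \dim (space_image B U) + c)%N) ->
  forall X : {vspace {ffun 'I_d -> V}},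
    (\dim X <= \dim (space_image (blowup d B) X) + c * d)%N.
Proof.
move=> Bc X; rewrite space_image_blowup dim_pow_space -mulnDl.
set U := (\sum_(k < d) _)%VS.
apply: (@leq_trans (\dim (pow_space d U))); last first.
  by rewrite dim_pow_space leq_mul2r Bc orbT.
apply/dimvS/subvP => u uX; apply/mem_pow_space => k.
by rewrite (subvP (sumv_sup k isT (subvv _))) // -pow_projE memv_img.
Qed.

Lemma blowup_shrink_pow (F : fieldType) (d c : nat) (V V' : vectType F)
    (B : {vspace 'Hom(V, V')}) (U : {vspace V}) :
  \dim U = (\dim (space_image B U) + c)%N ->
  (\dim (space_image (blowup d B) (pow_space d U)) + c * d <=
    \dim (pow_space d U))%N.
Proof.
move=> Uc; rewrite space_image_blowup !dim_pow_space -mulnDl leq_mul2r.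
apply/orP; right; rewrite Uc leq_add2r; apply/dimvS/space_imageS.
apply/subv_sumP => k _; apply/subvP => _ /memv_imgP [u /mem_pow_space uU ->].
by rewrite pow_projE.
Qed.

(** The chain dim X = dim (X :&: ker A) + dim A(X) <= s + dim B(X) <= dim X consists of
    equalities. *)
Lemma shrunk_lker (F : fieldType) (V V' : vectType F)
    (B : {vspace 'Hom(V, V')}) (A : 'Hom(V, V')) (s : nat) (X : {vspace V}) :
  A \in B -> (\dim (lker A) <= s)%N -> shrunk B s X ->
  [/\ (lker A <= X)%VS, space_image B X = (A @: X)%VS & \dim (lker A) = s].
Proof.
move=> AB kA Xs.
have AX : (A @: X <= space_image B X)%VS.
  by apply/subvP => _ /memv_imgP [u uX ->]; exact: mem_space_image.
have := limg_ker_dim A X; have := dimvS AX; have := dimvS (capvSr X (lker A)).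
move: Xs; rewrite /shrunk => Xs d1 d2 d3; split; last by lia.
- have /eqP <- : (X :&: lker A == lker A)%VS by rewrite eqEdim capvSr; lia.
  exact: capvSl.
- by apply/esym/eqP; rewrite eqEdim AX; lia.
Qed.

Lemma pseudo_inverseK (F : fieldType) (V V' : vectType F) (A : 'Hom(V, V'))
    (B : 'Hom(V', V)) (v : V) :
  pseudo_inverse A B -> A (B (A v)) = A v.
Proof.
case=> C [kC _ BA]; have : v \in (lker A + C)%VS by rewrite kC memvf.
case/memv_addP => k; rewrite memv_ker => /eqP Ak [w wC ->].
by rewrite linearD /= Ak add0r BA.
Qed.

(** Since A B A = A, the vector B(A v) differs from v by an element of ker A. *)
Lemma pseudo_inverse_img (F : fieldType) (V V' : vectType F) (A : 'Hom(V, V'))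
    (B : 'Hom(V', V)) (X : {vspace V}) :
  pseudo_inverse A B -> (lker A <= X)%VS -> (B @: (A @: X) <= X)%VS.
Proof.
move=> AB kX; apply/subvP => _ /memv_imgP [_ /memv_imgP [v vX ->] ->].
rewrite -(rpredBl (B (A v)) vX) (subvP kX) // memv_ker linearB.
by rewrite /= pseudo_inverseK // subrr.
Qed.

(** * Copies of the spaces W(x) and the subspaces X_T, Y_T *)

Lemma copy_projE (F : fieldType) (Q : quiver) (W : rep F Q)
    (m : vertex Q -> nat) (d : nat) (i : 'I_d * copies m)
    (u : blowup_sum W m d) : copy_proj W i u = u i.1 i.2.
Proof. by rewrite comp_lfunE dsum_projE pow_projE. Qed.

Lemma copy_injE (F : fieldType) (Q : quiver) (W : rep F Q)
    (m : vertex Q -> nat) (d : nat) (i : 'I_d * copies m) (w : W (tag i.2)) :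
  copy_inj W i w = pow_inj (mult_sum W m) i.1
    (@dsum_in F _ (fun j : copies m => W (tag j)) i.2 w).
Proof. by rewrite comp_lfunE; congr (_ _); exact: dsum_injE. Qed.

Lemma copy_injK (F : fieldType) (Q : quiver) (W : rep F Q)
    (m : vertex Q -> nat) (d : nat) (i : 'I_d * copies m) (w : W (tag i.2)) :
  copy_proj W i (copy_inj W i w) = w.
Proof. by rewrite copy_projE copy_injE pow_injE ffunE eqxx dsum_in_same. Qed.

Lemma copy_inj_diff (F : fieldType) (Q : quiver) (W : rep F Q)
    (m : vertex Q -> nat) (d : nat) (i j : 'I_d * copies m) (w : W (tag i.2)) :
  i != j -> copy_proj W j (copy_inj W i w) = 0.
Proof.
move=> nij; rewrite copy_projE copy_injE pow_injE ffunE.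
have [e1|_] := eqVneq j.1 i.1; last first.
  exact: (@dsum_mkE F _ (fun k : copies m => W (tag k)) (fun=> 0)).
apply: (@dsum_in_diff F _ (fun k : copies m => W (tag k))).
apply: contra nij => /eqP e2.
by rewrite -pair_eqE /pair_eq e1 e2 !eqxx.
Qed.

Lemma dsum_in_sum (F : fieldType) (I : finType) (V : I -> vectType F)
    (u : dsum V) : \sum_i dsum_in (u i) = u.
Proof.
apply/dsumP => k; rewrite -dsum_projE linear_sum (bigD1 k) //= big1.
  by rewrite addr0 dsum_projE dsum_in_same.
by move=> i nik; rewrite dsum_projE dsum_in_diff.
Qed.

Lemma copy_inj_sum (F : fieldType) (Q : quiver) (W : rep F Q)
    (m : vertex Q -> nat) (d : nat) (u : blowup_sum W m d) :
  \sum_(i : 'I_d * copies m) copy_inj W i (copy_proj W i u) = u.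
Proof.
rewrite -[RHS]pow_inj_sum.
rewrite -(pair_bigA _ (fun k i => copy_inj W (k, i) (copy_proj W (k, i) u))) /=.
apply: eq_bigr => k _; rewrite -[in RHS](dsum_in_sum (u k)) linear_sum.
apply: eq_bigr => i _.
by rewrite (@copy_injE F Q W m d (k, i)) (@copy_projE F Q W m d (k, i)).
Qed.

Lemma mem_blowup_sub (F : fieldType) (Q : quiver) (W : rep F Q)
    (m : vertex Q -> nat) (d : nat) (T : forall x, {vspace W x})
    (u : blowup_sum W m d) :
  u \in blowup_sub m d T <->
  (forall i : 'I_d * copies m, copy_proj W i u \in T (tag i.2)).
Proof.
exact: (mem_capv_preim (fun i => copy_proj W i) (fun i => T (tag i.2))).
Qed.

Lemma copy_inj_blowup_sub (F : fieldType) (Q : quiver) (W : rep F Q)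
    (m : vertex Q -> nat) (d : nat) (T : forall x, {vspace W x})
    (i : 'I_d * copies m) (w : W (tag i.2)) :
  w \in T (tag i.2) -> copy_inj W i w \in blowup_sub m d T.
Proof.
move=> wT; apply/mem_blowup_sub => j.
have [ij|nij] := eqVneq i j; last by rewrite copy_inj_diff ?mem0v.
by case: j / ij; rewrite copy_injK.
Qed.

Lemma blowup_subS (F : fieldType) (Q : quiver) (W : rep F Q)
    (m : vertex Q -> nat) (d : nat) (T U : forall x, {vspace W x}) :
  (forall x, (T x <= U x)%VS) -> (blowup_sub m d T <= blowup_sub m d U)%VS.
Proof.
move=> TU; apply/subvP => u /mem_blowup_sub uT; apply/mem_blowup_sub => i.
exact: (subvP (TU _) _ (uT i)).
Qed.

Lemma dim_blowup_sub (F : fieldType) (Q : quiver) (W : rep F Q)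
    (m : vertex Q -> nat) (d : nat) (T : forall x, {vspace W x}) :
  \dim (blowup_sub m d T) = ((\sum_x m x * \dim (T x)) * d)%N.
Proof.
rewrite (dim_capv_preim (q := fun i => copy_inj W i) (fun i => T (tag i.2))).
- rewrite -(pair_bigA _ (fun (k : 'I_d) (i : copies m) => \dim (T (tag i)))) /=.
  rewrite sum_nat_const card_ord mulnC; congr (_ * _)%N.
  rewrite -(sig_big_dep (fun=> true) (fun _ => predT)
    (fun x (j : 'I_(m x)) => \dim (T x))).
  by apply: eq_bigr => x _; rewrite sum_nat_const card_ord.
- exact: copy_injK.
- exact: copy_inj_diff.
- exact: copy_inj_sum.
Qed.

(** * Path maps, the matrix space and subrepresentations *)

Lemma subrep_path (F : fieldType) (Q : quiver) (W : rep F Q)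
    (T : forall x, {vspace W x}) (x y : vertex Q) (p : qpath x y) (w : W x) :
  subrep T -> w \in T x -> Defs.path_map W p w \in T y.
Proof.
move=> sT wT; elim: p => [|a p IH] /=; first by rewrite id_lfunE.
by rewrite comp_lfunE (subvP (sT a)) // memv_img.
Qed.

Lemma path_block_app (F : fieldType) (Q : quiver) (W : rep F Q)
    (m m' : vertex Q -> nat) (M : 'Hom(mult_sum W m, mult_sum W m'))
    (i : copies m) (j : copies m') (w : W (tag i)) :
  (dsum_proj (fun j : copies m' => W (tag j)) j \o M
    \o dsum_inj (fun i : copies m => W (tag i)) i)%VF w =
  M (@dsum_in F _ (fun i : copies m => W (tag i)) i w) j.
Proof.
rewrite !comp_lfunE; transitivity (M (dsum_inj _ i w) j).
  exact: (@dsum_projE F (copies m') (fun j : copies m' => W (tag j)) j).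
by congr (M _ j); exact: dsum_injE.
Qed.

Lemma matrix_space_blowup_sub (F : fieldType) (Q : quiver) (W : rep F Q)
    (sigma : vertex Q -> int) (d : nat) (T : forall x, {vspace W x}) :
  subrep T ->
  (space_image (blowup d (matrix_space W sigma)) (blowup_sub (wpos sigma) d T)
    <= blowup_sub (wneg sigma) d T)%VS.
Proof.
move=> sT; apply/space_image_subP => N u NB /mem_blowup_sub uT.
move: NB; apply: lin_span_apply => _ [E [M [/matrix_spaceP MA ->]]].
apply/mem_blowup_sub => -[k j]; rewrite copy_projE kronE ffunE /=.
rewrite -dsum_projE linear_sum; apply: memv_suml => l _.
rewrite linearZ; apply: memvZ; rewrite -(dsum_in_sum (u l)) !linear_sum /=.
apply: memv_suml => i _; have := uT (l, i); rewrite copy_projE /= => uli.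
have blockT : (dsum_proj _ j \o M \o dsum_inj _ i)%VF (u l i) \in T (tag j).
  apply: (@lin_span_apply _ _ _ (fun f => exists p : qpath (tag i) (tag j),
    f = Defs.path_map W p)); last exact/lin_spanP/MA.
  by move=> _ [p ->]; exact: subrep_path.
rewrite path_block_app in blockT.
apply: etrans blockT; congr (_ \in T _).
exact: (@dsum_projE F _ (fun j : copies (wneg sigma) => W (tag j)) j).
Qed.

Lemma path_block_matrix_space (F : fieldType) (Q : quiver) (W : rep F Q)
    (sigma : vertex Q -> int) (i : copies (wpos sigma))
    (j : copies (wneg sigma)) (p : qpath (tag i) (tag j)) :
  (dsum_inj (fun j : copies (wneg sigma) => W (tag j)) j \o Defs.path_map W p
    \o dsum_proj (fun i : copies (wpos sigma) => W (tag i)) i)%VF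
  \in matrix_space W sigma.
Proof.
apply/matrix_spaceP => i' j'; apply/lin_spanP.
(* The block of the map at ([i'], [j']) is W(p) at the chosen position and zero elsewhere. *)
set M := (_ \o _)%VF; suff : M = 0 \/ lin_comb
    (fun f => exists p : qpath (tag i') (tag j'), f = Defs.path_map W p) M.
  by case=> [->|/lin_spanP //]; exact: mem0v.
pose Vp (i : copies (wpos sigma)) := W (tag i).
pose Vn (j : copies (wneg sigma)) := W (tag j).
have ME w : M w =
    @dsum_in F _ Vn j (Defs.path_map W p (@dsum_in F _ Vp i' w i)) j'.
  rewrite /M path_block_app !comp_lfunE.
  apply: (congr1 (fun v : dsum Vn => v j')).
  transitivity (@dsum_in F _ Vn j (Defs.path_map W p
      (dsum_proj Vp i (@dsum_in F _ Vp i' w)))).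
    exact: (@dsum_injE F _ Vn).
  by congr (@dsum_in F _ Vn j (Defs.path_map W p _));
    exact: (@dsum_projE F _ Vp).
have [ii'|nii'] := eqVneq i' i; last first.
  left; apply/lfunP => w; rewrite ME (@dsum_in_diff F _ Vp i' i w nii') linear0.
  rewrite zero_lfunE -(@dsum_injE F _ Vn) linear0.
  exact: (@dsum_mkE F _ Vn (fun=> 0)).
have [jj'|njj'] := eqVneq j j'; last first.
  by left; apply/lfunP => w; rewrite ME (@dsum_in_diff F _ Vn) // zero_lfunE.
right; clearbody M; case: j' / jj' M ME => M ME; case: i / ii' p M ME => p M ME.
apply/lin_spanP/mem_lin_span; exists p; apply/lfunP => w.
by rewrite ME !dsum_in_same.
Qed.

(** The subrepresentation of W generated by the components of the vectors of X. *)
Definition path_closure (F : fieldType) (Q : quiver) (W : rep F Q)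
    (m : vertex Q -> nat) (d : nat) (X : {vspace blowup_sum W m d})
    (y : vertex Q) : {vspace W y} :=
  lin_span (fun w => exists (i : 'I_d * copies m) (p : qpath (tag i.2) y) u,
    u \in X /\ w = Defs.path_map W p (copy_proj W i u)).

Lemma subrep_path_closure (F : fieldType) (Q : quiver) (W : rep F Q)
    (m : vertex Q -> nat) (d : nat) (X : {vspace blowup_sum W m d}) :
  subrep (path_closure X).
Proof.
move=> a; apply/subvP => _ /memv_imgP [w wX ->]; rewrite memv_preim.
move: wX; apply/subvP/lin_span_subP => _ [i [p [u [uX ->]]]].
rewrite -memv_preim; apply: mem_lin_span; exists i, (qsnoc p), u.
by split; rewrite //= comp_lfunE.
Qed.

Lemma sub_path_closure (F : fieldType) (Q : quiver) (W : rep F Q)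
    (m : vertex Q -> nat) (d : nat) (X : {vspace blowup_sum W m d}) :
  (X <= blowup_sub m d (path_closure X))%VS.
Proof.
apply/subvP => u uX; apply/mem_blowup_sub => i; apply: mem_lin_span.
by exists i, (qnil _), u; rewrite id_lfunE.
Qed.

(** A generator W(p) u_i placed in any codomain copy is the value at u of a matrix unit tensored
    with the single block W(p), which belongs to the blow-up. *)
Lemma path_closure_image (F : fieldType) (Q : quiver) (W : rep F Q)
    (sigma : vertex Q -> int) (d : nat)
    (X : {vspace blowup_sum W (wpos sigma) d}) :
  (blowup_sub (wneg sigma) d (path_closure X)
    <= space_image (blowup d (matrix_space W sigma)) X)%VS.
Proof.
apply/subvP => v /mem_blowup_sub vX; rewrite -(copy_inj_sum v).
apply: memv_suml => j _; rewrite memv_preim; move: (vX j).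
apply/subvP/lin_span_subP => _ [i [p [u [uX ->]]]]; rewrite -memv_preim.
case: i p => [l i] p; case: j p => [k j] p.
have := mem_space_image
  (mem_kron_blowup (delta_mx k l) (path_block_matrix_space W p)) uX.
by rewrite kron_delta !comp_lfunE pow_projE.
Qed.

(** * Subrepresentations of the extended quiver, and the optimal witness *)

(** The new arrows carry exactly the blocks of B, so stability under all of them is stability of the
    direct sums under B. *)
Lemma subrep_plusP (F : fieldType) (Q : quiver) (W : rep F Q)
    (sigma : vertex Q -> int) (d : nat)
    (B : 'Hom(blowup_sum W (wneg sigma) d, blowup_sum W (wpos sigma) d))
    (T : forall x, {vspace W x}) :
  @subrep F (quiver_plus sigma d) (rep_plus B) T <->
  subrep T /\
    (B @: blowup_sub (wneg sigma) d T <= blowup_sub (wpos sigma) d T)%VS.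
Proof.
split=> [sT|[sT BT] [a|[j i]]]; last 2 first.
- exact: sT.
- apply/subvP => _ /memv_imgP [w wT ->]; rewrite /= 2!comp_lfunE.
  have : B (copy_inj W j w) \in blowup_sub (wpos sigma) d T.
    by rewrite (subvP BT) // memv_img // copy_inj_blowup_sub.
  by move=> /mem_blowup_sub H; exact: (H i).
split=> [a|]; first exact: (sT (inl a)).
apply/subvP => _ /memv_imgP [v /mem_blowup_sub vT ->].
apply/mem_blowup_sub => i; rewrite -(copy_inj_sum v) !linear_sum.
apply: memv_suml => j _; rewrite (subvP (sT (inr (j, i)))) //=.
have -> : copy_proj W i (B (copy_inj W j (copy_proj W j v))) =
    (copy_proj W i \o B \o copy_inj W j)%VF (copy_proj W j v).
  by rewrite !comp_lfunE.
exact: (memv_img _ (vT j)).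
Qed.

Lemma kernel_part_subP (F : fieldType) (Q : quiver) (W : rep F Q)
    (sigma : vertex Q -> int) (d : nat)
    (A : 'Hom(blowup_sum W (wpos sigma) d, blowup_sum W (wneg sigma) d))
    (T : forall x, {vspace W x}) :
  (forall x, (kernel_part A x <= T x)%VS) <->
  (lker A <= blowup_sub (wpos sigma) d T)%VS.
Proof.
split=> [KT|/subvP kT x].
  apply/subvP => u uA; apply/mem_blowup_sub => -[k [x j]] /=.
  rewrite (subvP (KT x)) // (subvP (sumv_sup (k, j) isT (subvv _))) //.
  exact: memv_img.
apply/subv_sumP => -[k j] _; apply/subvP => _ /memv_imgP [u uA ->].
have /mem_blowup_sub H := kT u uA.
exact: (H (k, Tagged (fun x => 'I_(wpos sigma x)) j)).
Qed.

Lemma weight_dimE (F : fieldType) (Q : quiver) (W : rep F Q)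
    (sigma : vertex Q -> int) (d : nat) (T : forall x, {vspace W x}) :
  weight_dim sigma T * d%:Z = (\dim (blowup_sub (wpos sigma) d T))%:Z
    - (\dim (blowup_sub (wneg sigma) d T))%:Z.
Proof.
rewrite !dim_blowup_sub !PoszM -mulrBl; congr (_ * _).
have pz (f : vertex Q -> nat) :
    (\sum_x f x)%N%:Z = \sum_x (f x)%:Z by exact: raddf_sum.
rewrite !pz -sumrB; apply: eq_bigr => x _; rewrite !PoszM -mulrBl.
by congr (_ * _); rewrite /wpos /wneg; lia.
Qed.

Theorem proposition3p4 (F : fieldType) (Q : quiver) (hQ : acyclic Q)
    (W : rep F Q) (sigma : vertex Q -> int)
    (hF : card_gt F (min_dim W sigma))
    (d : nat) (hd0 : (0 < d)%N) (hd : (min_dim W sigma - 1 <= d)%N)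
    (c : nat) (hc : max_shrinking (matrix_space W sigma) c)
    (A : 'Hom(blowup_sum W (wpos sigma) d, blowup_sum W (wneg sigma) d))
    (hA : A \in blowup d (matrix_space W sigma))
    (hrk : is_ncrk (blowup d (matrix_space W sigma)) (\dim (limg A)))
    (B : 'Hom(blowup_sum W (wneg sigma) d, blowup_sum W (wpos sigma) d))
    (hB : pseudo_inverse A B)
    (W' : forall x : vertex Q, {vspace W x})
    (hW' : @smallest_subrep_above F (quiver_plus sigma d) (rep_plus B)
             (kernel_part A) W') :
  [/\ shrunk (blowup d (matrix_space W sigma)) (c * d)
        (blowup_sub (wpos sigma) d W'),
      space_image (blowup d (matrix_space W sigma))
        (blowup_sub (wpos sigma) d W') = blowup_sub (wneg sigma) d W'
    & optimal_witness sigma W'].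
Proof.
case: hc => -[U0 U0c] cmax; case: hW' => /subrep_plusP [sW' BW'].
move=> /kernel_part_subP kW' minW'.
set Bl := blowup d _ in hA hrk *.
have shr := blowup_shrink_le (d := d) cmax.
(* Rank-nullity, with rk A at least the dimension of the domain minus cd. *)
have kerA : (\dim (lker A) <= c * d)%N.
  have := ncrk_ge hrk shr; have := limg_ker_dim A fullv.
  by rewrite capfv => <-; lia.
pose T := path_closure (pow_space d U0).
have sT : subrep T by exact: subrep_path_closure.
pose X := blowup_sub (wpos sigma) d T.
have imX : (space_image Bl X <= space_image Bl (pow_space d U0))%VS.
  exact: subv_trans (matrix_space_blowup_sub _ _ sT) (path_closure_image _).
(* Passing from the power of [U0] to [X] enlarges the subspace but not its image. *)
have Xc : shrunk Bl (c * d) X.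
  apply: leq_trans (leq_add (dimvS imX) (leqnn _)) _.
  exact: leq_trans (blowup_shrink_pow d U0c) (dimvS (sub_path_closure _)).
have [kX BlX dkA] := shrunk_lker hA kerA Xc.
have YX : (blowup_sub (wneg sigma) d T = A @: X)%VS.
  apply: subv_anti; rewrite -BlX matrix_space_blowup_sub // andbT.
  apply: subv_trans (path_closure_image _) _.
  exact/space_imageS/sub_path_closure.
have W'T : forall x, (W' x <= T x)%VS.
  apply: minW'; last exact/kernel_part_subP.
  by apply/subrep_plusP; split=> //; rewrite YX; exact: pseudo_inverse_img.
(* Any y in Y_W' lies in Y_T, hence in im A, so y = A(B y); and B y lies in X_W' because W' is
   stable under B. *)
have YW' : (blowup_sub (wneg sigma) d W' <=
    A @: blowup_sub (wpos sigma) d W')%VS.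
  apply/subvP => y yW'.
  have : y \in (A @: X)%VS by rewrite -YX (subvP (blowup_subS _ _ W'T)).
  case/memv_imgP => v _ yv.
  rewrite yv -(pseudo_inverseK v hB) memv_img // (subvP BW') // memv_img //.
  by rewrite -yv.
have ABl : (A @: blowup_sub (wpos sigma) d W' <=
    space_image Bl (blowup_sub (wpos sigma) d W'))%VS.
  by apply/subvP => _ /memv_imgP [u uW' ->]; exact: mem_space_image.
have imW' : space_image Bl (blowup_sub (wpos sigma) d W') =
    blowup_sub (wneg sigma) d W'.
  apply: subv_anti; rewrite matrix_space_blowup_sub //=.
  exact: subv_trans YW' ABl.
have dimW' : \dim (blowup_sub (wpos sigma) d W') =
    (\dim (blowup_sub (wneg sigma) d W') + c * d)%N.
  have := limg_ker_dim A (blowup_sub (wpos sigma) d W').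
  have -> : (blowup_sub (wpos sigma) d W' :&: lker A = lker A)%VS.
    exact/capv_idPr.
  suff -> : (A @: blowup_sub (wpos sigma) d W' =
      blowup_sub (wneg sigma) d W')%VS.
    by rewrite dkA; lia.
  by apply: subv_anti; rewrite YW' andbT -imW'.
split=> //; first by rewrite /shrunk imW' dimW'.
(* After scaling by d > 0, the bound cd on the shrinking of X_U is compared with the exact value cd
   for W'. *)
split=> // U sU; rewrite -(ler_pM2r (_ : 0 < d%:Z)) // !weight_dimE.
have : (\dim (blowup_sub (wpos sigma) d U) <=
    \dim (blowup_sub (wneg sigma) d U) + c * d)%N.
  apply: leq_trans (shr _) _; rewrite leq_add2r.
  exact: dimvS (matrix_space_blowup_sub sigma d sU).
by rewrite dimW'; lia.
Qed.
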